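(* There is an algorithm that, given an instance $(G,c,k)$ of \textsc{Edge-Colorable Subgraph (ECS)} with $G=(V,E)$, $n=|V|$, $m=|E|$, computes in $\mathcal{O}(n+m)$ time an equivalent instance of \textsc{ECS} (i.e. the output is a yes-instance if and only if $(G,c,k)$ is) whose graph has at most $4\,\xi_{c-1}\cdot c$ vertices and $\mathcal{O}(\xi_{c-1}\cdot c^2)$ edges. In other words, \textsc{ECS} admits a problem kernel of this size, computable in $\mathcal{O}(n+m)$ time.
   Context: All graphs are simple and undirected. A $c$-colored labeling of $G=(V,E)$ is a partition $L=(S^1_L,\dots,S^c_L,W_L)$ of $E$ into $c$ strong color classes $S^i_L$ and a class $W_L$ of weak edges. It is proper if no two distinct edges sharing an endpoint lie in the same strong class $S^i_L$. \textsc{ECS}: given a graph $G$ and integers $c,k\in\mathbb{N}$, decide whether $G$ has a proper $c$-colored labeling $L$ with $|W_L|\le k$. For $t\in\mathbb{N}$, $\xi_t$ denotes the minimum number of edges whose deletion from $G$ yields a graph of maximum degree at most $t$; here $t=c-1$. *)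

(* Defs.v *)
From mathcomp Require Import all_boot.

Set Implicit Arguments.
Unset Strict Implicit.
Unset Printing Implicit Defensive.

(* Edges are two-element vertex sets, so graphs are simple and undirected. *)
Record sgraph := SGraph {
  vertex : finType;
  edges : {set {set vertex}};
  edges_card2 : forall e, e \in edges -> #|e| = 2 }.

Definition degree (G : sgraph) (v : vertex G) : nat :=
  #|[set e in edges G | v \in e]|.

Definition max_degree (G : sgraph) : nat := \max_(v : vertex G) degree v.

Fact del_edges_subproof (G : sgraph) (D : {set {set vertex G}}) e :
  e \in edges G :\: D -> #|e| = 2.
Proof. by case/setDP=> eG _; apply: edges_card2. Qed.

Definition del_edges (G : sgraph) (D : {set {set vertex G}}) : sgraph :=
  SGraph (@del_edges_subproof G D).

Definition is_deletion_set (G : sgraph) (t : nat) (D : {set {set vertex G}}) :=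
  (D \subset edges G) && (max_degree (del_edges D) <= t).

Definition xi (t : nat) (G : sgraph) : nat :=
  #|[arg min_(D < edges G | is_deletion_set t D) #|D|]|.

(* The default value [edges G] in [xi] is admissible, so [xi] is a minimum. *)
Lemma xiP (t : nat) (G : sgraph) :
  (exists2 D : {set {set vertex G}}, is_deletion_set t D & #|D| = xi t G) /\
  (forall D : {set {set vertex G}}, is_deletion_set t D -> xi t G <= #|D|).
Proof.
rewrite /xi; case: arg_minnP => [|D DP Dmin]; last by split; [exists D|].
rewrite /is_deletion_set subxx; apply/bigmax_leqP => v _.
suff -> : degree (G := del_edges (edges G)) v = 0 by [].
by apply: eq_card0 => e; rewrite inE /= setDv inE.
Qed.

Record labeling (G : sgraph) (c : nat) := Labeling {
  strong : 'I_c -> {set {set vertex G}};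
  weak : {set {set vertex G}};
  labeling_cover : (\bigcup_i strong i) :|: weak = edges G;
  strong_disjoint : forall i j, i != j -> [disjoint strong i & strong j];
  strong_weak_disjoint : forall i, [disjoint strong i & weak] }.

Definition proper (G : sgraph) (c : nat) (L : labeling G c) : Prop :=
  forall (i : 'I_c) (e f : {set vertex G}),
    e \in strong L i -> f \in strong L i -> e != f -> e :&: f = set0.

Record instance := Instance {
  graph : sgraph;
  colors : nat;
  budget : nat }.

Definition ECS (I : instance) : Prop :=
  exists L : labeling (graph I) (colors I), proper L /\ #|weak L| <= budget I.

Definition n_vertices (G : sgraph) : nat := #|vertex G|.
Definition n_edges (G : sgraph) : nat := #|edges G|.

(* Edge-list encoding: n, m, c, k, followed by the two endpoints of each edge,
   for an arbitrary numbering of the vertices by 0, ..., n - 1 and with the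
   edges, and the endpoints of each edge, listed in an arbitrary order. *)
Definition encodes (w : seq nat) (I : instance) : Prop :=
  exists (num : vertex (graph I) -> nat)
         (es : seq (vertex (graph I) * vertex (graph I))),
    [/\ injective num,
        forall v, num v < n_vertices (graph I),
        perm_eq [seq [set p.1; p.2] | p <- es] (enum (edges (graph I))) &
        w = [:: n_vertices (graph I); n_edges (graph I); colors I; budget I]
              ++ flatten [seq [:: num p.1; num p.2] | p <- es]].

(* A structured word RAM: registers and a memory of cells, both indexed by nat
   and holding natural numbers.  The only arithmetic operations are addition
   and truncated subtraction; every instruction and every evaluation of a test
   costs one unit of time. *)
Inductive operand := Reg of nat | Imm of nat.

Inductive test := Eq of operand & operand | Lt of operand & operand.

Inductive cmd :=
  | Skip
  | Move of nat & operand
  | Add of nat & operand & operand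
  | Sub of nat & operand & operand
  | Read of nat & operand
  | Write of operand & operand
  | Seq of cmd & cmd
  | If of test & cmd & cmd
  | While of test & cmd.

Record state := State { regs : nat -> nat; mem : nat -> nat }.

Definition upd (f : nat -> nat) (i x : nat) : nat -> nat :=
  fun j => if j == i then x else f j.

Definition set_reg (s : state) (r x : nat) : state :=
  State (upd (regs s) r x) (mem s).

Definition set_mem (s : state) (i x : nat) : state :=
  State (regs s) (upd (mem s) i x).

Definition val_op (s : state) (a : operand) : nat :=
  match a with Reg r => regs s r | Imm x => x end.

Definition val_test (s : state) (b : test) : bool :=
  match b with
  | Eq x y => val_op s x == val_op s y
  | Lt x y => val_op s x < val_op s y
  end.

(* [exec B p s t s']: started in [s], the program [p] halts in [s'] after
   exactly [t] time units, and every value written on the way is at most [B],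
   the largest machine word.  An overflowing instruction has no successor
   state. *)
Inductive exec (B : nat) : cmd -> state -> nat -> state -> Prop :=
  | ExecSkip s : exec B Skip s 1 s
  | ExecMove s r x : val_op s x <= B ->
      exec B (Move r x) s 1 (set_reg s r (val_op s x))
  | ExecAdd s r x y : val_op s x + val_op s y <= B ->
      exec B (Add r x y) s 1 (set_reg s r (val_op s x + val_op s y))
  | ExecSub s r x y : val_op s x - val_op s y <= B ->
      exec B (Sub r x y) s 1 (set_reg s r (val_op s x - val_op s y))
  | ExecRead s r x : mem s (val_op s x) <= B ->
      exec B (Read r x) s 1 (set_reg s r (mem s (val_op s x)))
  | ExecWrite s x y : val_op s x <= B -> val_op s y <= B ->
      exec B (Write x y) s 1 (set_mem s (val_op s x) (val_op s y))
  | ExecSeq p q s t1 s1 t2 s2 :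
      exec B p s t1 s1 -> exec B q s1 t2 s2 -> exec B (Seq p q) s (t1 + t2) s2
  | ExecIfTrue b p q s t s' : val_test s b ->
      exec B p s t s' -> exec B (If b p q) s t.+1 s'
  | ExecIfFalse b p q s t s' : ~~ val_test s b ->
      exec B q s t s' -> exec B (If b p q) s t.+1 s'
  | ExecWhileTrue b p s t1 s1 t2 s2 : val_test s b ->
      exec B p s t1 s1 -> exec B (While b p) s1 t2 s2 ->
      exec B (While b p) s (t1 + t2).+1 s2
  | ExecWhileFalse b p s : ~~ val_test s b -> exec B (While b p) s 1 s.

(* Runs are unique, so a run with given cost and final state is the run. *)
Lemma exec_det (B : nat) (p : cmd) (s : state) (t1 t2 : nat) (s1 s2 : state) :
  exec B p s t1 s1 -> exec B p s t2 s2 -> t1 = t2 /\ s1 = s2.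
Proof.
move=> run1; elim: run1 t2 s2 => {p s t1 s1};
  intros; match goal with H : exec _ _ _ _ ?x |- _ = _ /\ _ = ?x =>
    inversion H; subst end => //;
  repeat match goal with
  | T : is_true ?b, F : is_true (~~ ?b) |- _ => by rewrite T in F
  | IH : (forall u x, exec _ ?p ?s u x -> _), H : exec _ ?p ?s _ _ |- _ =>
      case: (IH _ _ H) => {H} ? ?; subst
  end; by [].
Qed.

Definition init_state (w : seq nat) : state := State (fun=> 0) (nth 0 w).

Definition holds (s : state) (w : seq nat) : Prop :=
  forall i, i < size w -> mem s i = nth 0 w i.

(* Memory outside the input is zero, and the output starts, like the input, at
   address 0. *)
Definition runs (B : nat) (p : cmd) (w : seq nat) (t : nat) (w' : seq nat) :=
  exists2 s' : state, exec B p (init_state w) t s' & holds s' w'.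

(* Words of log (n + m + c + k + 1) + O(1) bits, the additive constant being
   determined by [a]. *)
Definition word_bound (a : nat) (I : instance) : nat :=
  a * (n_vertices (graph I) + n_edges (graph I) + colors I + budget I).+1.

(* Main.v *)
Require Import Defs.
From mathcomp Require Import all_boot zify.

(* Let H be the set of vertices of degree at least c.  The kernel is the
   subgraph induced by H and its neighbours, with c and k unchanged.  A removed
   vertex and all its neighbours have degree less than c, hence miss a colour
   in every proper partial colouring; Vizing's fan argument then colours the
   edges at removed vertices one after another without uncolouring any edge.

   For the size, a minimum deletion set D has at least deg v - (c-1) >= 1 edges
   at every v in H, and each edge of D has two ends.  Thus |H| <= 2 xi and the
   degrees in H sum to at most 2 xi + (c-1)|H| <= 2 xi c, which bounds the
   neighbours of H and the edges at H; the other kept vertices have degree less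
   than c. *)

Set Implicit Arguments.
Unset Strict Implicit.
Unset Printing Implicit Defensive.

(** * Vizing fans *)

(** Keeping the neighbours of H, and not H alone, is what makes fans available: all vertices of a
    fan at u are neighbours of u, so colouring an edge at a removed u needs missing colours only at
    u and its neighbours, whereas a neighbour of degree at least c may miss none. Weak edges are
    simply uncoloured; apart from the edge being coloured, a fan consists of coloured edges, so the
    colouring of the kernel may leave any edges uncoloured. Recolouring can reach into the kernel,
    so its colours are not preserved; only the set of coloured edges is tracked, and it can only
    grow. This bounds the weak edges without any control of the colours. Chains are handled without
    paths or degrees: a colour acts on vertices as an involution that fixes those missing it, and a
    chain is the orbit of two involutions, whose ends are their fixed points. The program compares
    degrees with c and never computes a deletion set; [xi] enters only in the analysis of the
    output. *)

Section AlternatingWalk.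
Variables (T : eqType) (f g : T -> T) (x : T).
Hypotheses (fK : involutive f) (gK : involutive g) (fx : f x = x).

Let turn k := if odd k then f else g.

(** The walk begins with [g] because [f] fixes [x]: the start is an end of its chain. *)
Fixpoint walk (k : nat) : T :=
  if k is k'.+1 then (if odd k' then f else g) (walk k') else x.

Let turnK k : involutive (turn k).
Proof. by rewrite /turn; case: ifP. Qed.

(** One of the two involutions continues the walk; the other undoes its last step, or fixes [x] at
    the start. *)
Lemma walk_step (k l : nat) : exists2 j, j <= k.+1 & turn l (walk k) = walk j.
Proof.
have [lk|lk] := eqVneq (odd l) (odd k).
  by exists k.+1 => //=; rewrite /turn lk.
case: k lk => [|k] lk; first by exists 0 => //=; rewrite /turn; case: odd lk.
exists k; first lia.
have -> : turn l = turn k by rewrite /turn; move: lk => /=; do 2 case: odd.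
exact: turnK.
Qed.

(** After a step that does not move, the walk can only retrace itself, so its vertices up to index
    [k] are closed under both involutions. *)
Lemma walk_stop (k : nat) :
  turn k (walk k) = walk k -> forall l, exists2 j, j <= k & walk l = walk j.
Proof.
move=> stop; elim=> [|l [j jk lj]]; first by exists 0.
rewrite -[walk l.+1]/(turn l (walk l)) lj.
have [jk'|] := ltnP j k.
  by have [i ij ->] := walk_step j l; exists i => //; lia.
move=> kj; have {jk kj} -> : j = k by lia.
have [lk|lk] := eqVneq (odd l) (odd k).
  by exists k => //; rewrite -{2}stop /turn lk.
case: k {stop} lk => [|k] lk; first by exists 0 => //=; rewrite /turn; case: odd lk.
exists k; first lia.
have -> : turn l = turn k by rewrite /turn; move: lk => /=; do 2 case: odd.
exact: turnK.
Qed.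

(* A later fixed point of [f] or [g] is where the walk stops, so there is at
   most one. *)
Lemma walk_fixed_uniq (y z : T) (k l : nat) :
    y = walk k -> z = walk l -> y != x -> z != x ->
  f y = y \/ g y = y -> f z = z \/ g z = z -> y = z.
Proof.
(* At its first occurrence [w] was entered from a different vertex, so the involution used there
   does not fix it; hence the next one does. *)
have first w i : w = walk i -> w != x -> f w = w \/ g w = w ->
    exists j, [/\ w = walk j, turn j (walk j) = walk j
                & forall h, w = walk h -> j <= h].
  move=> wi wx fgw.
  have ex : exists i, w == walk i by exists i; apply/eqP.
  case: (ex_minnP ex) => j /eqP wj jmin; exists j; split=> // [|h /eqP]; last exact: jmin.
  case: j wj jmin => [|j] wj jmin; first by rewrite wj eqxx in wx.
  have : turn j w != w.
    apply/eqP => tw; suff /jmin : w == walk j by rewrite ltnn.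
    by rewrite -{1}tw wj -[walk j.+1]/(turn j (walk j)) turnK.
  by rewrite -wj /turn /=; case: odd => /eqP; case: fgw.
move=> yk zl yx zx fgy fgz.
have [k' [yk' sk kmin]] := first _ _ yk yx fgy.
have [l' [zl' sl lmin]] := first _ _ zl zx fgz.
(* Each stop confines the other vertex to indices up to its own, so minimality forces [k'] and [l']
   to be equal. *)
have [i ik ti] := walk_stop sk l'; have [j jl tj] := walk_stop sl k'.
have := lmin i; rewrite zl' ti => /(_ erefl) li.
have := kmin j; rewrite yk' tj => /(_ erefl) kj.
by rewrite -ti -tj; congr walk; lia.
Qed.

End AlternatingWalk.

(** * Partial edge colourings, Kempe exchanges and fans *)

Section EdgeColoring.
Variables (T : finType) (C : eqType).
Implicit Types (col : T -> T -> option C) (a b : C).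

Definition proper_col col : Prop :=
  [/\ forall x, col x x = None,
      forall x y, col x y = col y x &
      forall x y z a, col x y = Some a -> col x z = Some a -> y = z].

Definition misses col x a : bool := [forall y, col x y != Some a].

Lemma missesP col x a : reflect (forall y, col x y != Some a) (misses col x a).
Proof. exact: forallP. Qed.

(** The default [x] makes this a total involution on proper colourings and turns ends of chains into
    fixed points. *)
Definition mate col a x : T := if [pick y | col x y == Some a] is Some y then y else x.

Lemma mateP col a x y : proper_col col -> col x y = Some a -> mate col a x = y.
Proof.
move=> [_ _ inj] xy; rewrite /mate; case: pickP => [z /eqP xz|/(_ y)].
  exact: inj xz xy.
by rewrite xy eqxx.
Qed.

Lemma mate_misses col a x : misses col x a -> mate col a x = x.
Proof.
move=> /missesP xa; rewrite /mate; case: pickP => // y.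
by rewrite (negPf (xa y)).
Qed.

Lemma mateK col a : proper_col col -> involutive (mate col a).
Proof.
move=> pcol x; have [_ sym _] := pcol.
have [y /eqP xy|xa] := pickP (fun y => col x y == Some a).
  by rewrite (mateP pcol xy); apply: mateP; rewrite // sym.
have xm : mate col a x = x by apply/mate_misses/missesP => y; rewrite xa.
by rewrite !xm.
Qed.

Definition swap a b d := if d == a then b else if d == b then a else d.

Lemma swapK a b : involutive (swap a b).
Proof.
rewrite /swap => d; have [->|da] := eqVneq d a; first by rewrite eqxx; case: eqP.
by have [->|db] := eqVneq d b; rewrite ?eqxx ?(negPf da) ?(negPf db).
Qed.

Lemma swap_id a b d : d != a -> d != b -> swap a b d = d.
Proof. by rewrite /swap => /negPf -> /negPf ->. Qed.

(** Only the first end is tested; symmetry relies on [S] being closed under edges coloured [a] or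
    [b]. *)
Definition kempe col a b (S : pred T) (x y : T) :=
  if S x then omap (swap a b) (col x y) else col x y.

Lemma kempe_isSome col a b S x y : kempe col a b S x y = col x y :> bool.
Proof. by rewrite /kempe; case: (S x); case: (col x y). Qed.

Lemma kempe_eq col a b S x y d :
  (kempe col a b S x y == Some d)
  = (col x y == Some (if S x then swap a b d else d)).
Proof.
rewrite /kempe; case: (S x) => //; case: (col x y) => //= e.
by apply/eqP/eqP => [[<-]|[->]]; rewrite swapK.
Qed.

Lemma misses_kempe col a b S x d :
  misses (kempe col a b S) x d = misses col x (if S x then swap a b d else d).
Proof. by apply: eq_forallb => y; rewrite kempe_eq. Qed.

(** [S] is the chain of [u]. Since [u] misses [a], it is one end of the chain, and another vertex
    that misses [b] must be the opposite end. *)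
Lemma kempe_chain col a b u : proper_col col -> misses col u a ->
  exists S : pred T, [/\ proper_col (kempe col a b S), S u &
    forall y z, S y -> S z -> misses col y b -> misses col z b ->
      y != u -> z != u -> y = z].
Proof.
move=> pcol ua; have [irr sym inj] := pcol.
set e := fun x y => (y == mate col a x) || (y == mate col b x).
have au : mate col a u = u by apply: mate_misses.
exists (connect e u); split; last first.
- move=> y z uy uz yb zb yu zu.
  have walked w : connect e u w -> exists k, w = walk (mate col a) (mate col b) u k.
    case/connectP => p; elim/last_ind: p w => [|p w' IHp] w.
      by move=> _ ->; exists 0.
    rewrite rcons_path last_rcons => /andP[/IHp /(_ erefl) [k wk] ew] ->.
    rewrite wk in ew.
    (* The parities 1 and 0 select [mate col a] and [mate col b], so the walk exhausts the whole
       component. *)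
    have [i _ ai] := walk_step (mateK a pcol) (mateK b pcol) au k 1.
    have [j _ bj] := walk_step (mateK a pcol) (mateK b pcol) au k 0.
    by case/orP: ew => /eqP ->; [exists i | exists j].
  have [[k yk] [l zl]] := (walked y uy, walked z uz).
  apply: (walk_fixed_uniq (mateK a pcol) (mateK b pcol) au yk zl) => //; right;
    exact: mate_misses.
- exact: connect0.
have closed x y d : col x y = Some d -> (d == a) || (d == b) ->
    connect e u x = connect e u y.
  have closed1 x' y' : col x' y' = Some d -> (d == a) || (d == b) ->
      connect e u x' -> connect e u y'.
    move=> xy dab ux; apply: connect_trans ux (connect1 _); rewrite /e.
    by case/orP: dab => /eqP dE; rewrite -dE (mateP pcol xy) eqxx ?orbT.
  move=> xy dab; apply/idP/idP; apply: closed1 => //; by rewrite sym.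
split=> [x|x y|x y z d].
- by rewrite /kempe irr; case: ifP.
- rewrite /kempe -(sym x y); case xy: (col x y) => [d|]; last by do 2 case: ifP.
  have [dab|] := boolP ((d == a) || (d == b)); first by rewrite (closed _ _ _ xy dab).
  by rewrite negb_or => /andP[da db] /=; rewrite swap_id //; do 2 case: ifP.
- by move/eqP; rewrite kempe_eq => /eqP xy /eqP; rewrite kempe_eq => /eqP; exact: inj xy.
Qed.

Definition set_color col (u v : T) (o : option C) (x y : T) :=
  if (x == u) && (y == v) || (x == v) && (y == u) then o else col x y.

Lemma set_color_proper col u v o : proper_col col -> u != v ->
    (forall a, o = Some a -> misses col u a /\ misses col v a) ->
  proper_col (set_color col u v o).
Proof.
move=> [irr sym inj] uv om; rewrite /set_color; split=> [x|x y|x y z a].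
- have [->|xu] := eqVneq x u; first by rewrite (negPf uv) andbF irr.
  by rewrite andbF irr.
- by rewrite (sym y x) orbC !(andbC (y == _)).
- have out w t : o = Some a -> (w == u) || (w == v) -> col w t <> Some a.
    by move=> /om[/missesP um /missesP vm] /orP[] /eqP -> /eqP;
      rewrite ?(negPf (um _)) ?(negPf (vm _)).
  case: ifP => xy; case: ifP => xz //.
  + move: xz; case/orP: xy => /andP[/eqP -> /eqP ->]; rewrite eqxx.
      by rewrite (negPf uv) orbF => /eqP.
    by rewrite (eq_sym v u) (negPf uv) => /eqP.
  + move=> oa /out; case; first by [].
    by case/orP: xy => /andP[-> _]; rewrite ?orbT.
  + move=> ca /out h; case: (h x y) => //.
    by case/orP: xz => /andP[-> _]; rewrite ?orbT.
  + exact: inj.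
Qed.

(** The edge [u z] is coloured, and its colour could be handed over to [u y] as far as [y] is
    concerned. *)
Definition fan col u : rel T :=
  fun y z => if col u z is Some a then misses col y a else false.

Lemma path_imply (e e' : rel T) x s :
    {in x :: s & s, forall p q, e p q -> e' p q} -> path e x s -> path e' x s.
Proof.
move=> ee' /(pathP x) es; apply/(pathP x) => i ilt.
apply: ee'; last exact: es; rewrite mem_nth //=; exact: ltnW.
Qed.

(** Only the domain of the colouring is compared, which leaves room for recolouring. *)
Definition adds_edge col u v col' : Prop :=
  forall x y, col' x y = [|| col x y : bool, (x == u) && (y == v) | (x == v) && (y == u)] :> bool.

(** The colour of [u z] moves to [u y], which leaves a shorter fan whose uncoloured edge is [u z];
    the last edge receives [a]. Clearing [u z] first frees its colour at [u], so every intermediate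
    colouring is proper. *)
Lemma fan_rotate col u y s a :
    proper_col col -> path (fan col u) y s -> uniq (y :: s) -> u != y ->
    col u y = None -> misses col (last y s) a -> misses col u a ->
  exists2 col', proper_col col' & adds_edge col u y col'.
Proof.
elim: s col y => [|z s IHs] col y pcol.
  move=> _ _ uy _ /= ya ua; exists (set_color col u y (Some a)).
    by apply: set_color_proper => // b [<-].
  by move=> x w; rewrite /set_color; case: ifP; rewrite ?orbT ?orbF.
have [irr sym inj] := pcol.
rewrite [path _ _ _]/= {1}/fan; case uz: (col u z) => [d|//] /andP[yd zs].
move=> ys uy uy0 lasta ua.
have zu : u != z by apply/eqP => zu; rewrite -zu irr in uz.
have yz : y != z by move: ys; rewrite /= inE negb_or -andbA => /and3P[].
pose col0 := set_color col u z None; pose col1 := set_color col0 u y (Some d).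
have pcol0 : proper_col col0 by apply: set_color_proper.
have pcol1 : proper_col col1.
  apply: set_color_proper => // b [<-]; split; apply/missesP => w; rewrite /col0 /set_color;
    case: ifP => // uwz; last exact: (missesP _ _ _ yd).
  apply/eqP => /(inj _ _ _ _ uz) zw; by rewrite zw !eqxx in uwz.
(* The remaining fan avoids [u] and [y], so no vertex of it gains a colour; [z] loses one. *)
have mono p e : p \in z :: s -> misses col p e -> misses col1 p e.
  move=> ps /missesP pe; apply/missesP => w; rewrite /col1 /col0 /set_color.
  have py : p != y by apply: contraTneq ps => ->; case/andP: ys.
  have pu : p != u.
    apply: contraTneq ps => pu; apply/negP; rewrite pu inE (negPf zu) /= => us.
    have : forall e' : rel T, e' =2 fan col u -> path e' z s -> u \in s -> false.
      move=> e' ee /(pathP z) es /(nthP z) [i ilt iu].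
      by have := es i ilt; rewrite ee iu /fan irr.
    by move/(_ _ (fun _ _ => erefl) zs us).
  by rewrite (negPf py) (negPf pu) /=; case: ifP => // _; exact: pe.
have [||||||col' pcol' addz] := IHs col1 z pcol1.
- apply: path_imply zs => p q ps qs; rewrite /fan.
  have [qz qy] : q != z /\ q != y.
    by case/and3P: ys; rewrite inE negb_or => /andP[_ ys] zs' _; split; apply: contraTneq qs => ->.
  have -> : col1 u q = col u q.
    by rewrite /col1 /col0 /set_color (negPf qz) (negPf qy) (negPf uy) (negPf zu) /= ?andbF.
  by case: (col u q) => // e; exact: mono.
- by case/andP: ys.
- exact: zu.
- by rewrite /col1 /col0 /set_color (negPf uy) !eqxx eq_sym (negPf yz).
- by apply: mono; [exact: mem_last | exact: lasta].
- apply/missesP => w; rewrite /col1 /col0 /set_color.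
  case: ifP => _; last by case: ifP => // _; exact: (missesP _ _ _ ua).
  by rewrite -uz; exact: (missesP _ _ _ ua).
exists col' => // x w; rewrite addz /col1 /col0 /set_color.
case: ifP => xy; first by rewrite !orbT.
case: ifP => xz; last by rewrite !orbF.
by case/orP: xz => /andP[/eqP -> /eqP ->]; rewrite ?(sym z u) uz.
Qed.

(* Vizing's fan argument.  A fan of maximal length ends in a vertex missing a
   colour [b] that [u] misses too, or that colours an earlier fan edge [u z].
   In the second case exchange [b] with a colour [a] missing at [u] along the
   chain from [u]: either the fan cut before [z] or the whole fan survives, and
   its last vertex and [u] then both miss [b]. *)
Lemma add_edge col u v :
    proper_col col -> u != v -> col u v = None ->
    (forall w, [|| w == u, w == v | col u w] -> exists a, misses col w a) ->
  exists2 col', proper_col col' & adds_edge col u v col'.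
Proof.
move=> pcol uv uv0 miss; have [irr sym inj] := pcol.
have [a ua] : exists a, misses col u a by apply: miss; rewrite eqxx.
(* [n] bounds how often the fan can still be lengthened: at 0 the [size s + 1] distinct vertices of
   [v :: s] would outnumber [T]. *)
suff ext n s : path (fan col u) v s -> uniq (v :: s) -> #|T| <= n + size s ->
    exists2 col', proper_col col' & adds_edge col u v col'.
  by apply: (ext #|T| [::]) => //; rewrite addn0.
elim: n s => [|n IHn] s vs us.
  rewrite add0n => Ts; have := max_card (mem (v :: s)).
  by rewrite (card_uniqP us) /= ltnNge Ts.
move=> Ts.
have nbr w : w \in s -> col u w.
  move=> /(nthP v) [i ilt <-]; have /(pathP v)/(_ i ilt) := vs.
  by rewrite /fan; case: (col u _).
have notu w : w \in v :: s -> w != u.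
  rewrite inE => /orP[/eqP ->|/nbr]; first by rewrite eq_sym.
  by apply: contraTneq => ->; rewrite irr.
have [b lastb] : exists b, misses col (last v s) b.
  apply: miss; have := mem_last v s; rewrite inE => /orP[->|/nbr ->]; by rewrite !orbT.
have [ub|] := boolP (misses col u b); first exact: fan_rotate lastb ub.
rewrite negb_forall => /existsP[z]; rewrite negbK => /eqP uz.
have vz : v != z by apply/eqP => vz; rewrite -vz uv0 in uz.
have [zs|zs] := boolP (z \in s); last first.
  apply: (IHn (rcons s z)).
  - by rewrite rcons_path vs /= /fan uz.
  - by rewrite -rcons_cons rcons_uniq us inE negb_or eq_sym vz zs.
  - by rewrite size_rcons addnS.
have [S [pcol' Su uniqS]] := kempe_chain b pcol ua.
pose col' := kempe col a b S.
have add' : (exists2 col1, proper_col col1 & adds_edge col' u v col1) ->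
    exists2 col1, proper_col col1 & adds_edge col u v col1.
  by case=> col1 pcol1 add1; exists col1 => // x y; rewrite add1 kempe_isSome.
have ub' : misses col' u b.
  rewrite misses_kempe Su /swap eqxx; by case: eqP => [->|_].
have uv0' : col' u v = None.
  by have := kempe_isSome col a b S u v; rewrite uv0 -/col'; case: (col' u v).
(* The colour of [u q] is neither [a], missing at [u], nor [b], used on [u z], so the exchange does
   not affect this step of the fan. *)
have fan' p q : q != z -> fan col u p q -> fan col' u p q.
  rewrite /fan /col' {1}/kempe Su => qz; case uq: (col u q) => [d|] //= pd.
  have da : d != a by apply: contraNneq (missesP _ _ _ ua q) => <-; rewrite uq.
  have db : d != b by apply: contra_neq qz => db; apply: inj uz; rewrite uq db.
  by rewrite !(swap_id da db) misses_kempe; case: ifP; rewrite ?(swap_id da db).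
move: vs us Ts lastb nbr notu {IHn}; case/splitPr: zs => s1 s2 vs us Ts lastb nbr notu.
move: (vs); rewrite cat_path /= => /and3P[vs1 zb zs2].
have {zb} lastb1 : misses col (last v s1) b by move: zb; rewrite /fan uz.
have zs1 : z \notin s1 by move: us; rewrite cons_uniq cat_uniq /= => /and4P[_ _ /norP[]].
have zs2' : z \notin s2 by move: us; rewrite cons_uniq cat_uniq /= => /and5P[].
have in1 : last v s1 \in v :: s1 ++ z :: s2.
  by rewrite -cat_cons mem_cat mem_last.
have in2 : last z s2 \in z :: s2 by exact: mem_last.
apply: add'; have [S1|S1] := boolP (S (last v s1)); last first.
  apply: (@fan_rotate _ _ _ s1 b) => //.
  - by apply: path_imply vs1 => p q _ qs1; apply: fan'; apply: contraNneq zs1 => <-.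
  - by move: us; rewrite -cat_cons cat_uniq => /andP[].
  - by rewrite misses_kempe (negPf S1).
have lastE : last v (s1 ++ z :: s2) = last z s2 by rewrite last_cat.
rewrite lastE in lastb.
(* The chain already has the predecessor of [z] as its opposite end, so the distinct last fan vertex
   lies off it and keeps missing [b]. *)
have S2 : ~~ S (last z s2).
  apply/negP => S2.
  have E : last v s1 = last z s2.
    apply: uniqS => //; apply: notu => //; by rewrite inE mem_cat in2 !orbT.
  move: us; rewrite -cat_cons cat_uniq => /and3P[_ /hasPn/(_ _ in2) h _].
  by rewrite /= -E mem_last in h.
apply: (@fan_rotate _ _ _ (s1 ++ z :: s2) b) => //.
- rewrite cat_path /=; apply/and3P; split.
  + by apply: path_imply vs1 => p q _ qs1; apply: fan'; apply: contraNneq zs1 => <-.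
  (* The exchange gives [u z] colour [a], and the predecessor of [z], on the chain, now misses [a]
     instead of [b]. *)
  + have -> : fan col' u (last v s1) z = misses col' (last v s1) a.
      rewrite /fan /col' {1}/kempe Su uz /= /swap eqxx; by case: (eqVneq b a) => [->|].
    by rewrite misses_kempe S1 /swap eqxx.
  + by apply: path_imply zs2 => p q _ qs1; apply: fan'; apply: contraNneq zs2' => <-.
- by rewrite lastE misses_kempe (negPf S2).
Qed.

End EdgeColoring.

(** * Safety and size of the kernel *)

Section Edges.
Variable G : sgraph.
Implicit Types (x y u : vertex G) (e : {set vertex G}).

Lemma edge_neq x y : [set x; y] \in edges G -> x != y.
Proof. by move=> /edges_card2; rewrite cards2; case: eqP. Qed.

Lemma edgeE e x : e \in edges G -> x \in e -> exists y, e = [set x; y].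
Proof.
move=> /edges_card2/eqP/cards2P[y [z [yz ->]]]; rewrite !inE => /orP[] /eqP ->.
  by exists z.
by exists y; rewrite setUC.
Qed.

Lemma edge_ends e : e \in edges G -> exists x y, e = [set x; y].
Proof. by move=> /edges_card2/eqP/cards2P[y [z [_ ->]]]; exists y, z. Qed.

Lemma set2_inj (T : finType) (x y z : T) : [set x; y] = [set x; z] -> y = z.
Proof.
move=> E; have : y \in [set x; z] by rewrite -E set22.
rewrite !inE => /orP[/eqP yx|/eqP //]; move: (set22 x z).
by rewrite -E yx !inE orbb => /eqP.
Qed.

Lemma card_nbrs x : #|[set y | [set x; y] \in edges G]| = degree x.
Proof.
rewrite -(card_imset _ (@set2_inj _ x)); apply: eq_card => e; rewrite inE.
apply/imsetP/andP => [[y]|[eG /(edgeE eG)[y ey]]].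
  by rewrite inE => yG ->; rewrite yG set21.
by exists y; rewrite // inE -ey.
Qed.

End Edges.

(** [W] need only contain the uncoloured edges. With this slack it can be transported between graphs
    without being the exact weak class. *)
Definition colorable_outside (G : sgraph) (c : nat) (W : {set {set vertex G}}) : Prop :=
  exists col : vertex G -> vertex G -> option 'I_c,
    [/\ proper_col col, forall x y, col x y -> [set x; y] \in edges G &
      forall x y, [set x; y] \in edges G -> col x y \/ [set x; y] \in W].

Lemma ECSP (I : instance) :
  ECS I <-> exists2 W, @colorable_outside (graph I) (colors I) W & #|W| <= budget I.
Proof.
split=> [[L [pL Lk]]|[W [col [[irr sym inj] colE colW]] Wk]].
  have sE i e : e \in strong L i -> e \in edges (graph I).
    by move=> ei; rewrite -(labeling_cover L) inE; apply/orP; left; apply/bigcupP; exists i.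
  have irr x i : [set x; x] \notin strong L i.
    by apply/negP => /sE /edge_neq; rewrite eqxx.
  exists (weak L) => //; exists (fun x y => [pick i | [set x; y] \in strong L i]); split.
  - split=> [x|x y|x y z i].
    + by case: pickP => // i; rewrite (negPf (irr _ _)).
    + by rewrite setUC.
    + case: pickP => // j xy [<-]; case: pickP => // j' xz [jj]; rewrite jj in xz.
      apply: (@set2_inj _ x); apply/eqP/negPn/negP => /(pL _ _ _ xy xz)/setP/(_ x).
      by rewrite !inE eqxx.
  - by move=> x y; case: pickP => // i /sE.
  - move=> x y; rewrite -{1}(labeling_cover L) inE => /orP[/bigcupP[i _ xy]|]; last by right.
    by left; case: pickP => // /(_ i); rewrite xy.
pose S i := [set e | [exists x, exists y, (e == [set x; y]) && (col x y == Some i)]].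
have SP i e : reflect (exists x y, e = [set x; y] /\ col x y = Some i) (e \in S i).
  rewrite inE; apply: (iffP existsP) => [[x /existsP[y /andP[/eqP ? /eqP ?]]]|[x [y [-> xy]]]].
    by exists x, y.
  by exists x; apply/existsP; exists y; rewrite eqxx xy eqxx.
have atS i e x : e \in S i -> x \in e -> exists2 y, e = [set x; y] & col x y = Some i.
  move=> /SP[x' [y' [-> xy]]]; rewrite !inE => /orP[] /eqP ->; first by exists y'.
  by exists x'; rewrite 1?setUC // sym.
have cover : (\bigcup_i S i) :|: (edges (graph I) :\: \bigcup_i S i) = edges (graph I).
  apply/setP => e; rewrite !inE; case: (boolP (e \in \bigcup_i S i)) => //= /bigcupP[i _].
  by case/SP=> x [y [-> xy]]; rewrite colE ?xy.
have disj i j : i != j -> [disjoint S i & S j].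
  move=> ij; rewrite -setI_eq0; apply/eqP/setP => e; rewrite in_setI in_set0.
  apply: contraNF ij => /andP[ei ej].
  have /SP[x [y [exy xy]]] := ei.
  have xe : x \in e by rewrite exy set21.
  have [z exz xz] := atS _ _ _ ej xe.
  have yz : y = z by apply: (@set2_inj _ x); rewrite -exy.
  by move: xy; rewrite yz xz => -[->].
have disjw i : [disjoint S i & edges (graph I) :\: \bigcup_i S i].
  rewrite -setI_eq0; apply/eqP/setP => e; rewrite in_setI in_setD in_set0.
  by apply/negP => /and3P[ei /bigcupP[]]; exists i.
exists (Labeling cover disj disjw); split=> /=.
  move=> i e f ei fi ef; apply/setP => x; rewrite !inE; apply: contraNF ef => /andP[xe xf].
  have [y -> xy] := atS _ _ _ ei xe; have [z -> xz] := atS _ _ _ fi xf.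
  by rewrite (inj _ _ _ _ xy xz).
apply: leq_trans Wk; apply/subset_leq_card/subsetP => e; rewrite inE => /andP[enS eG].
have [x [y exy]] := edge_ends eG; rewrite exy in eG *.
case: (colW x y eG) => //; case xy: (col x y) => [i|] // _.
by case/bigcupP: enS; exists i => //; apply/SP; exists x, y.
Qed.

(** * Safety: extending colourings from an induced subgraph *)

Section Induced.
Variables (G : sgraph) (K : {set vertex G}).

Fact induced_card2 (e : {set {x | x \in K}}) :
  e \in [set e' : {set {x | x \in K}} | val @: e' \in edges G] -> #|e| = 2.
Proof. by rewrite inE => /edges_card2; rewrite (card_imset _ val_inj). Qed.

Definition induced : sgraph := SGraph induced_card2.

Lemma induced_edge (x y : vertex induced) :
  ([set x; y] \in edges induced) = ([set val x; val y] \in edges G).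
Proof. by rewrite inE imsetU1 imset_set1. Qed.

(** If no colour were missing, sending each colour to its edge at [w] would inject [c] colours into
    the edges at [w]. *)
Lemma low_degree_misses (c : nat) (col : vertex G -> vertex G -> option 'I_c) w :
    proper_col col -> (forall x y, col x y -> [set x; y] \in edges G) ->
  degree w < c -> exists a, misses col w a.
Proof.
move=> pcol colE wc; apply/existsP; apply: contraTT wc => /existsPn all.
rewrite -leqNgt -{1}(card_ord c).
have used a : col w (mate col a w) = Some a.
  have := all a; rewrite negb_forall => /existsP[y]; rewrite negbK => /eqP wy.
  by rewrite (mateP pcol wy).
have inj : injective (fun a => [set w; mate col a w]).
  by move=> a b /set2_inj E; have := used a; rewrite E used => -[].
rewrite -(card_codom inj); apply/subset_leq_card/subsetP => e /codomP[a ->].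
by rewrite !inE eqxx colE ?used.
Qed.

Lemma extend_outside (c : nat) (col0 : vertex G -> vertex G -> option 'I_c) :
    (forall u w, u \notin K -> (w == u) || ([set u; w] \in edges G) -> degree w < c) ->
    proper_col col0 -> (forall x y, col0 x y -> [set x; y] \in edges G) ->
  exists col : vertex G -> vertex G -> option 'I_c,
    [/\ proper_col col, forall x y, col x y -> [set x; y] \in edges G,
      forall x y, col0 x y -> col x y &
      forall x y, [set x; y] \in edges G -> x \notin K -> col x y].
Proof.
move=> low pcol0 col0E.
(* Ordered pairs are processed one at a time; those that are non-edges, start in [K] or are already
   coloured change nothing. *)
suff ext (ps : seq (vertex G * vertex G)) :
    exists col : vertex G -> vertex G -> option 'I_c,
    [/\ proper_col col, forall x y, col x y -> [set x; y] \in edges G,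
      forall x y, col0 x y -> col x y &
      forall x y, (x, y) \in ps -> [set x; y] \in edges G -> x \notin K -> col x y].
  have [col [? ? ? h]] := ext (enum [set: vertex G * vertex G]).
  by exists col; split=> // x y; apply: h; rewrite mem_enum inE.
elim: ps => [|[u v] ps [col [pcol colE col0c colps]]]; first by exists col0.
case: (boolP [&& [set u; v] \in edges G, u \notin K & ~~ col u v]); last first.
  move=> done; exists col; split=> // x y; rewrite inE.
  case/orP=> [/eqP[-> ->] uvG uK|]; last exact: colps.
  by move: done; rewrite uvG uK /= negbK.
case/and3P=> uvG uK uv0.
have uv0' : col u v = None by case: (col u v) uv0.
have [w|col' pcol' add] := add_edge pcol (edge_neq uvG) uv0'.
  move=> wuv; apply: (low_degree_misses pcol colE); apply: (low u w uK).
  by case/or3P: wuv => [->|/eqP ->|/colE ->]; rewrite ?uvG ?orbT.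
have [_ sym _] := pcol'.
exists col'; split=> //.
- move=> x y; rewrite add => /or3P[/colE //||] /andP[/eqP -> /eqP ->] //.
  by rewrite setUC.
- by move=> x y /col0c xy; rewrite add xy.
- move=> x y; rewrite inE => /orP[/eqP[-> ->]|xy] xyG xK; first by rewrite add !eqxx orbT.
  by rewrite add colps.
Qed.

(** Restriction creates no new weak edge. Conversely, the extension colours every edge with an end
    outside [K], so the uncoloured edges are images of old weak ones. *)
Lemma ECS_induced (c k : nat) :
    (forall u w, u \notin K -> (w == u) || ([set u; w] \in edges G) -> degree w < c) ->
  ECS (Instance induced c k) <-> ECS (Instance G c k).
Proof.
move=> low; rewrite !ECSP /=; split=> -[W [col [pcol colE colW]] Wk]; last first.
  exists [set e : {set vertex induced} | val @: e \in W].
    exists (fun x y => col (val x) (val y)); have [irr sym inj] := pcol; split.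
    + split=> // x y z a xy xz; apply: val_inj; exact: inj xy xz.
    + by move=> x y /colE; rewrite induced_edge.
    + by move=> x y; rewrite induced_edge => /colW[]; [left|right; rewrite inE imsetU1 imset_set1].
  apply: leq_trans Wk; rewrite -(card_imset _ (imset_inj val_inj)).
  by apply/subset_leq_card/subsetP => e /imsetP[e']; rewrite inE => ? ->.
have [irr sym inj] := pcol.
pose col0 x y :=
  if (insub x : option {x | x \in K}, insub y : option {x | x \in K})
    is (Some x', Some y') then col x' y' else None.
have col0P x y a : col0 x y = Some a -> exists x' y' : {x | x \in K},
    [/\ x = val x', y = val y' & col x' y' = Some a].
  by rewrite /col0; case: insubP => // x' _ <-; case: insubP => // y' _ <- ?; exists x', y'.
have [||col1 [pcol1 col1E col01 col1K]] := @extend_outside c col0 low.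
- split=> [x|x y|x y z a].
  + by rewrite /col0; case: insubP => // x' _ _; exact: irr.
  + by rewrite /col0; case: insubP => [x' _ _|_]; case: insubP => // y' _ _; exact: sym.
  + move=> /col0P[x' [y' [-> -> xy]]] /col0P[x2 [z' [/val_inj <- -> xz]]].
    by rewrite (inj _ _ _ _ xy xz).
- move=> x y; case xy: (col0 x y) => [a|] // _.
  have [x' [y' [-> -> xy']]] := col0P _ _ _ xy.
  by rewrite -induced_edge; apply: colE; rewrite xy'.
exists [set val @: (e : {set {x | x \in K}}) | e in W]; last first.
  by rewrite (card_imset _ (imset_inj val_inj)).
have [_ sym1 _] := pcol1.
exists col1; split=> // x y xyG.
have [xK|/(col1K _ _ xyG)] := boolP (x \in K); last by left.
have [yK|yK] := boolP (y \in K); last by left; rewrite sym1 col1K // setUC.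
have xyE : [set Sub x xK; Sub y yK : {x | x \in K}] \in edges induced.
  by rewrite induced_edge !SubK.
case: (colW _ _ xyE) => [xy|xyW].
  by left; apply: col01; rewrite /col0 !insubT.
right; apply/imsetP; exists [set Sub x xK; Sub y yK : {x | x \in K}] => //.
by rewrite imsetU1 imset_set1 !SubK.
Qed.

End Induced.

(** * Size bounds in terms of the deletion number *)

Section Counting.
Variables (G : sgraph) (c : nat).
Hypothesis c_gt0 : 0 < c.

Definition high : {set vertex G} := [set x | c <= degree x].
Definition kept : {set vertex G} :=
  [set x | (x \in high) || [exists y, (y \in high) && ([set x; y] \in edges G)]].

Lemma kept_low (u w : vertex G) :
  u \notin kept -> (w == u) || ([set u; w] \in edges G) -> degree w < c.
Proof.
rewrite !inE negb_or -ltnNge => /andP[uc /existsPn none] /orP[/eqP -> //|uw].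
by have := none w; rewrite uw andbT inE -ltnNge.
Qed.

Lemma sum_high_degree : \sum_(v in high) degree v <= (c - 1) * #|high| + 2 * xi (c - 1) G
  /\ #|high| <= 2 * xi (c - 1) G.
Proof.
have [[D /andP[DG Dmax] <-] _] := xiP (c - 1) G.
have deg v : degree v <= (c - 1) + #|[set e in D | v \in e]|.
  have := leq_trans (leq_bigmax (v : vertex (del_edges D))) Dmax.
  rewrite /degree /= => le1; apply: leq_trans (leq_add le1 (leqnn _)).
  apply: leq_trans (leq_card_setU _ _); apply/subset_leq_card/subsetP => e.
  by rewrite !inE; case: (e \in D) => //= /andP[eG ve]; rewrite ?eG ve.
have sumD : \sum_(v in high) #|[set e in D | v \in e]| <= 2 * #|D|.
  apply: (@leq_trans (\sum_(v : vertex G) #|[set e in D | v \in e]|)).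
    by rewrite [leqRHS](bigID (mem high)) leq_addr.
  have -> : 2 * #|D| = \sum_(e in D) #|e|.
    rewrite -[#|D|]sum1_card big_distrr /=; apply: eq_bigr => e eD.
    by rewrite (edges_card2 (subsetP DG e eD)).
  have -> : \sum_(e in D) #|e| = \sum_(e in D) \sum_(v | v \in e) 1.
    by apply: eq_bigr => e _; rewrite sum1_card.
  rewrite (exchange_big_dep predT) //=; apply/eq_leq/eq_bigr => v _.
  by rewrite sum1dep_card; apply: eq_card => e; rewrite !inE.
split.
  rewrite mulnC -sum_nat_const; apply: leq_trans (leq_add (leqnn _) sumD).
  by rewrite -big_split; exact: leq_sum.
apply: leq_trans sumD; rewrite -sum1_card; apply: leq_sum => v; rewrite inE => cv.
(* A vertex of degree at least [c], with [c] positive, exceeds [c - 1] and hence meets an edge of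
   [D]. *)
by have := deg v; lia.
Qed.

Lemma sum_high_le : \sum_(v in high) degree v <= 2 * xi (c - 1) G * c.
Proof.
have [h1 h2] := sum_high_degree; apply: leq_trans h1 _; nia.
Qed.

Lemma card_bigcup_le (I T : finType) (P : pred I) (F : I -> {set T}) :
  #|\bigcup_(i | P i) F i| <= \sum_(i | P i) #|F i|.
Proof.
elim/big_rec2: _ => [|i m A _ Am]; first by rewrite cards0.
by apply: leq_trans (leq_card_setU _ _) _; rewrite leq_add2l.
Qed.

Lemma card_kept : #|kept| <= 4 * xi (c - 1) G * c.
Proof.
have [_ h2] := sum_high_degree; have h1 := sum_high_le.
(* The factor 4 arises here: 2 xi + 2 xi c is at most 4 xi c because [c] is positive. *)
apply: (@leq_trans (#|high| + \sum_(v in high) degree v)); last nia.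
apply: (@leq_trans #|high :|: \bigcup_(v in high) [set y | [set v; y] \in edges G]|).
  apply/subset_leq_card/subsetP => x; rewrite 2![in X in X -> _]inE.
  case/orP=> [xh|/existsP[y /andP[yh xy]]]; first by rewrite inE inE xh.
  by rewrite inE; apply/orP; right; apply/bigcupP; exists y => //; rewrite inE setUC.
apply: leq_trans (leq_card_setU _ _) _; rewrite leq_add2l.
apply: leq_trans (card_bigcup_le _ _) _.
by apply/eq_leq/eq_bigr => v _; exact: card_nbrs.
Qed.

(** Charge each edge to one of its ends: high ends account for at most 2 xi c edges, and the at most
    4 xi c low kept ones for at most c - 1 each. The sum 2 xi c + 4 xi c (c - 1) is below the
    bound. *)
Lemma card_edges_induced_kept :
  #|edges (induced kept)| <= 4 * (xi (c - 1) G * c ^ 2).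
Proof.
have h1 := sum_high_le; have h3 := card_kept; have [_ h2] := sum_high_degree.
rewrite -(card_imset _ (imset_inj val_inj)).
pose inc v := [set e in edges G | v \in e].
apply: (@leq_trans #|\bigcup_(v in high) inc v :|: \bigcup_(v in kept :\: high) inc v|).
  apply/subset_leq_card/subsetP => e /imsetP[e' e'K ->].
  have [x [y exy]] := edge_ends e'K.
  move: (e'K); rewrite inE => eG.
  have xe : val x \in val @: e' by apply: imset_f; rewrite exy set21.
  have xinc : val @: e' \in inc (val x) by rewrite inE eG.
  rewrite inE; case: (boolP (val x \in high)) => xh; apply/orP; [left|right];
    apply/bigcupP; exists (val x) => //.
  by rewrite in_setD xh (valP x).
apply: leq_trans (leq_card_setU _ _) _.
have low : \sum_(v in kept :\: high) #|inc v| <= #|kept| * (c - 1).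
  apply: (@leq_trans (\sum_(v in kept :\: high) (c - 1))).
    by apply: leq_sum => v; rewrite !inE -ltnNge => /andP[vc _]; rewrite /inc -/(degree v); lia.
  by rewrite sum_nat_const leq_mul2r subset_leq_card ?orbT // subsetDl.
have := card_bigcup_le (mem high) inc; have := card_bigcup_le (mem (kept :\: high)) inc.
have -> : \sum_(i in mem high) #|inc i| = \sum_(v in high) degree v by [].
move=> b1 b2; apply: leq_trans (leq_add b2 (leq_trans b1 low)) _.
by rewrite -mulnn; nia.
Qed.

End Counting.

(** * Running time *)

(** The time is only an upper bound, so branches of different lengths share one cost. *)
Definition reaches (B : nat) (p : cmd) (s : state) (t : nat) (Q : state -> Prop) : Prop :=
  exists t' s', [/\ exec B p s t' s', t' <= t & Q s'].

Lemma reaches_seq B p q s t1 t2 P Q :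
    reaches B p s t1 P -> (forall s', P s' -> reaches B q s' t2 Q) ->
  reaches B (Seq p q) s (t1 + t2) Q.
Proof.
move=> [u1 [s1 [ex1 le1 P1]]] /(_ s1 P1)[u2 [s2 [ex2 le2 Q2]]].
by exists (u1 + u2), s2; split; [exact: ExecSeq ex1 ex2 | exact: leq_add |].
Qed.

(* Like [cost] below, only meaningful for loop-free programs. *)
Fixpoint wp (B : nat) (p : cmd) (Q : state -> Prop) (s : state) : Prop :=
  match p with
  | Skip => Q s
  | Move r x => val_op s x <= B /\ Q (set_reg s r (val_op s x))
  | Add r x y =>
      val_op s x + val_op s y <= B /\ Q (set_reg s r (val_op s x + val_op s y))
  | Defs.Sub r x y =>
      val_op s x - val_op s y <= B /\ Q (set_reg s r (val_op s x - val_op s y))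
  | Read r x => Defs.mem s (val_op s x) <= B /\ Q (set_reg s r (Defs.mem s (val_op s x)))
  | Write x y => (val_op s x <= B /\ val_op s y <= B) /\
      Q (set_mem s (val_op s x) (val_op s y))
  | Seq p q => wp B p (wp B q Q) s
  | If b p q => if val_test s b then wp B p Q s else wp B q Q s
  | While _ _ => False
  end.

Fixpoint cost (p : cmd) : nat :=
  match p with
  | Seq p q => cost p + cost q
  | If _ p q => (maxn (cost p) (cost q)).+1
  | _ => 1
  end.

Lemma wp_reaches B p Q s : wp B p Q s -> reaches B p s (cost p) Q.
Proof.
elim: p Q s => [|r x|r x y|r x y|r x|x y|p IHp q IHq|b p IHp q IHq|b p IHp] Q s //=.
- by move=> Qs; exists 1, s; split=> //; exact: ExecSkip.
- by case=> ok Qs; do 2 eexists; split; [exact: ExecMove | |].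
- by case=> ok Qs; do 2 eexists; split; [exact: ExecAdd | |].
- by case=> ok Qs; do 2 eexists; split; [exact: ExecSub | |].
- by case=> ok Qs; do 2 eexists; split; [exact: ExecRead | |].
- by case=> -[ok1 ok2] Qs; do 2 eexists; split; [exact: ExecWrite | |].
- by move=> /IHp pq; apply: reaches_seq pq _ => s' /IHq.
- case: ifP => [bs /IHp|/negbT bs /IHq] [t [s' [ex le Qs]]]; exists t.+1, s';
    split=> //; try exact: ExecIfTrue; try exact: ExecIfFalse;
    by rewrite ltnS leq_max le ?orbT.
Qed.

Lemma wp_mono B p (P Q : state -> Prop) s :
  (forall s', P s' -> Q s') -> wp B p P s -> wp B p Q s.
Proof.
elim: p P Q s => [|r x|r x y|r x y|r x|x y|p IHp q IHq|b p IHp q IHq|b p IHp] P Q s PQ //=;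
  try by case=> ? /PQ.
- exact: PQ.
- by apply: IHp => s'; exact: IHq.
- by case: ifP => _; [exact: IHp | exact: IHq].
Qed.

(** Symbolic execution of one instruction: [v] is a simplified form of the value stored, which keeps
    later states small. *)
Lemma wp_assign B p q (Q : state -> Prop) s r v :
    wp B p (eq (set_reg s r v)) s -> wp B q Q (set_reg s r v) ->
  wp B (Seq p q) Q s.
Proof. by move=> pP qQ; apply: wp_mono pP => s' <-. Qed.

(** The invariant is indexed by the number of completed rounds. Each round pays for its body and one
    test; the final [.+1] is the failing test. *)
Lemma while_reaches B b p N (Inv : nat -> state -> Prop) s :
    (forall i s, i <= N -> Inv i s -> val_test s b = (i < N)) ->
    (forall i s, i < N -> Inv i s -> wp B p (Inv i.+1) s) ->
  Inv 0 s -> reaches B (While b p) s (N * (cost p).+1).+1 (Inv N).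
Proof.
move=> test body.
suff gen i : i <= N -> Inv (N - i) s -> reaches B (While b p) s (i * (cost p).+1).+1 (Inv N).
  by move=> I0; apply: gen; rewrite ?subnn.
elim: i s => [|i IHi] s iN Is.
  exists 1, s; rewrite subn0 in Is; split=> //; apply: ExecWhileFalse.
  by rewrite (test _ _ _ Is) ?ltnn.
have lt : N - i.+1 < N by lia.
have [t1 [s1 [ex1 le1 I1]]] := wp_reaches (body _ _ lt Is).
have [||t2 [s2 [ex2 le2 I2]]] := IHi s1; first lia.
  by have -> : N - i = (N - i.+1).+1 by lia.
exists (t1 + t2).+1, s2; split=> //; last by rewrite mulSn; lia.
by apply: ExecWhileTrue ex1 ex2; rewrite (test _ _ _ Is) ?lt // ltnW.
Qed.

(** * The kernelization program and its invariants *)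

Local Notation "p ;; q" := (Seq p q) (at level 60, right associativity).
Local Notation "$ r" := (Reg r) (at level 2, format "$ r").
Local Notation "# x" := (Imm x) (at level 2, format "# x").

(* With E = 4 + 2m, cells 4, ..., E-1 hold the edge list, E, ..., E+n-1 the
   degrees, and E+n, ..., E+2n-1 first the marks of the kept vertices and then
   their new numbers plus one.  Registers 1, 2, 5 and 3 hold E, E+n, E+2n, c. *)
Definition setup : cmd :=
  Read 4 #1 ;; Add 1 $4 $4 ;; Add 1 $1 #4 ;; Read 4 #0 ;; Add 2 $1 $4 ;;
  Add 5 $2 $4 ;; Read 3 #2 ;; Move 0 #4.

Definition count_degree : cmd :=
  Read 4 $0 ;; Add 4 $4 $1 ;; Read 6 $4 ;; Add 6 $6 #1 ;; Write $4 $6 ;; Add 0 $0 #1.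

Definition mark_edge : cmd :=
  Read 4 $0 ;; Add 0 $0 #1 ;; Read 6 $0 ;; Add 0 $0 #1 ;;
  Add 7 $4 $1 ;; Read 7 $7 ;; Add 10 $6 $1 ;; Read 10 $10 ;;
  Add 4 $4 $2 ;; Add 6 $6 $2 ;;
  If (Lt $7 $3) (If (Lt $10 $3) Skip (Write $4 #1 ;; Write $6 #1))
    (Write $4 #1 ;; Write $6 #1).

Definition number_vertex : cmd :=
  Read 4 $0 ;; If (Eq $4 #0) Skip (Add 8 $8 #1 ;; Write $0 $8) ;; Add 0 $0 #1.

(* The output overwrites the edge list: register 9, the write position, never
   overtakes register 0, the read position. *)
Definition output_edge : cmd :=
  Read 4 $0 ;; Add 0 $0 #1 ;; Read 6 $0 ;; Add 0 $0 #1 ;;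
  Add 4 $4 $2 ;; Read 4 $4 ;; Add 6 $6 $2 ;; Read 6 $6 ;;
  If (Eq $4 #0) Skip (If (Eq $6 #0) Skip
    (Defs.Sub 4 $4 #1 ;; Write $9 $4 ;; Add 9 $9 #1 ;;
     Defs.Sub 6 $6 #1 ;; Write $9 $6 ;; Add 9 $9 #1 ;; Add 11 $11 #1)).

(** Only cells 0 and 1 of the header are rewritten: cells 2 and 3 already hold [c] and [k], which
    the kernel shares. *)
Definition kernelize : cmd :=
  setup ;; While (Lt $0 $1) count_degree ;;
  Move 0 #4 ;; While (Lt $0 $1) mark_edge ;;
  Move 0 $2 ;; While (Lt $0 $5) number_vertex ;;
  (Move 0 #4 ;; Move 9 #4) ;; While (Lt $0 $1) output_edge ;;
  Write #0 $8 ;; Write #1 $11.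

Definition flat (es : seq (nat * nat)) : seq nat :=
  flatten [seq [:: p.1; p.2] | p <- es].

Lemma size_flat es : size (flat es) = 2 * size es.
Proof. by elim: es => //= p es; rewrite /flat /= => ->; rewrite mulnS. Qed.

Lemma nth_flat es i :
  nth 0 (flat es) (2 * i) = (nth (0, 0) es i).1 /\
  nth 0 (flat es) (2 * i).+1 = (nth (0, 0) es i).2.
Proof.
elim: es i => [|p es IHes] i; first by rewrite !nth_nil.
case: i => [|i]; first by [].
by have [h1 h2] := IHes i; rewrite mulnS; split.
Qed.

Lemma flat_rcons es p : flat (rcons es p) = flat es ++ [:: p.1; p.2].
Proof. by rewrite /flat map_rcons flatten_rcons. Qed.

Section Run.
Variables (B n c k : nat) (es : seq (nat * nat)).
Let m := size es.
Let E := 4 + 2 * m.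
Let EE : E = 4 + 2 * m := erefl.
Hypothesis es_lt : forall v, v \in flat es -> v < n.
Hypothesis B_big : E + 2 * n + c <= B.

Let deg v := count_mem v (flat es).
Let w := [:: n; m; c; k] ++ flat es.

(** [r] is the part of the edge list scanned so far, while degrees are always taken in the whole of
    [es]; this is the marking loop's invariant. *)
Definition keeps (r : seq (nat * nat)) (v : nat) : bool :=
  has (fun p => ((c <= count_mem p.1 (flat es)) || (c <= count_mem p.2 (flat es)))
                && ((v == p.1) || (v == p.2))) r.

Let kp := keeps es.

Definition rank (v : nat) : nat := count (keeps es) (iota 0 v).

Definition out_edges (r : seq (nat * nat)) : seq (nat * nat) :=
  [seq (rank p.1, rank p.2) | p <- r & keeps es p.1 && keeps es p.2].

Let consts (r : nat -> nat) := [/\ r 1 = E, r 2 = E + n, r 3 = c & r 5 = E + 2 * n].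

Let layout (M : nat -> nat) (d f : nat -> nat) :=
  [/\ forall i, i < E -> M i = nth 0 w i,
      forall v, v < n -> M (E + v) = d v &
      forall v, v < n -> M (E + n + v) = f v].

Lemma w_end i : i < m -> [/\ nth 0 w (4 + 2 * i) = (nth (0, 0) es i).1,
  nth 0 w (4 + 2 * i).+1 = (nth (0, 0) es i).2,
  (nth (0, 0) es i).1 < n & (nth (0, 0) es i).2 < n].
Proof.
move=> im; have [e1 e2] := nth_flat es i; rewrite /= e1 e2; split=> //.
  by rewrite -e1 es_lt // mem_nth // size_flat -/m; lia.
by rewrite -e2 es_lt // mem_nth // size_flat -/m; lia.
Qed.

Lemma setup_reaches : reaches B setup (init_state w) (cost setup)
  (fun s => [/\ consts (regs s), regs s 0 = 4, layout (Defs.mem s) (fun=> 0) (fun=> 0)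
               & regs s 8 = 0 /\ regs s 11 = 0]).
Proof.
(* Memory beyond the input is zero, so the degree and mark arrays need no initialisation. *)
have out i : E <= i -> nth 0 w i = 0.
  by move=> Ei; rewrite nth_default // size_cat size_flat -/m /=; lia.
apply: wp_reaches; rewrite /= /upd /=; do !(split; first by lia).
split=> //.
- rewrite /consts /upd /= /E; split; lia.
- by split=> // v _; apply: out; lia.
Qed.

Let Inv1 j s := [/\ consts (regs s), regs s 0 = 4 + j,
  layout (Defs.mem s) (fun v => count_mem v (take j (flat es))) (fun=> 0)
  & regs s 8 = 0 /\ regs s 11 = 0].

Lemma count_degree_wp j s : j < 2 * m -> Inv1 j s -> wp B count_degree (Inv1 j.+1) s.
Proof.
move=> jm; case: s => r M [[/= r1 r2 r3 r5] r0 [/= Mx Md Mf] r8].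
rewrite /wp /= /upd /= !r0 !r1 Mx; last lia.
have -> : nth 0 w (4 + j) = nth 0 (flat es) j by [].
set v := nth 0 (flat es) j.
have vn : v < n by apply: es_lt; rewrite mem_nth // size_flat.
have EB : E + n <= B by lia.
rewrite (addnC v E) Md //.
have dv : count_mem v (take j (flat es)) <= j.
  by apply: leq_trans (count_size _ _) _; rewrite size_take; case: ifP => // /negbT; lia.
have jB : j.+1 < B by lia.
set d := count_mem v _ in dv *.
do !(split; first by lia).
split; rewrite /set_reg /set_mem /= /upd /= ?r1 ?r2 ?r3 ?r5 //.
- lia.
- split=> [i iE|u un|u un] /=; rewrite /upd.
  + by case: eqP => [|_]; [lia | exact: Mx].
  + rewrite eqn_add2l (take_nth 0) ?size_flat // -cats1 count_cat /= addn0 -/v.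
    by rewrite (eq_sym v); have [->|_] := eqVneq u v; rewrite ?addn0 ?Md.
  + by case: eqP => [|_]; [lia | exact: Mf].
Qed.


Lemma keeps_take i v : i < m ->
  keeps (take i.+1 es) v = keeps (take i es) v ||
    ((c <= deg (nth (0, 0) es i).1) || (c <= deg (nth (0, 0) es i).2)) &&
    ((v == (nth (0, 0) es i).1) || (v == (nth (0, 0) es i).2)).
Proof. by move=> im; rewrite (take_nth (0, 0)) // -cats1 /keeps has_cat /= orbF. Qed.

Let Inv2 i s := [/\ consts (regs s), regs s 0 = 4 + 2 * i,
  layout (Defs.mem s) deg (fun v => keeps (take i es) v)
  & regs s 8 = 0 /\ regs s 11 = 0].

Lemma deg_le v : deg v <= 2 * m.
Proof. by rewrite -size_flat count_size. Qed.

Lemma mark_edge_wp i s : i < m -> Inv2 i s -> wp B mark_edge (Inv2 i.+1) s.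
Proof.
case: s => r M im [cs r0 ms r8]; have [r1 r2 r3 r5] := cs; have [Mx Md Mf] := ms.
rewrite /= in r0 r1 r2 r3 r5 Mx Md Mf r8.
have [wa wb an bn] := w_end im.
have keepsE v := keeps_take v im.
have Ma : M (4 + 2 * i) = (nth (0, 0) es i).1 by rewrite Mx ?wa //; lia.
have Mb : M (4 + 2 * i).+1 = (nth (0, 0) es i).2 by rewrite Mx ?wb //; lia.
move: Ma Mb an bn keepsE {wa wb}.
set a := (nth _ es i).1; set b := (nth _ es i).2 => Ma Mb an bn keepsE.
have [la lb] := (deg_le a, deg_le b).
set da := deg a in la keepsE *; set db := deg b in lb keepsE *.
apply: (wp_assign (r := 4) (v := a)); first by rewrite /= r0 Ma; split=> //; lia.
apply: (wp_assign (r := 0) (v := (4 + 2 * i).+1)).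
  by rewrite /= /upd /= r0 addn1; split=> //; lia.
apply: (wp_assign (r := 6) (v := b)).
  by rewrite /= /upd /= Mb; split=> //; lia.
apply: (wp_assign (r := 0) (v := (4 + 2 * i).+2)).
  by rewrite /= /upd /= addn1; split=> //; lia.
apply: (wp_assign (r := 7) (v := E + a)).
  by rewrite /= /upd /= r1 addnC; split=> //; lia.
apply: (wp_assign (r := 7) (v := da)).
  by rewrite /= /upd /= Md //; split=> //; lia.
apply: (wp_assign (r := 10) (v := E + b)).
  by rewrite /= /upd /= r1 addnC; split=> //; lia.
apply: (wp_assign (r := 10) (v := db)).
  by rewrite /= /upd /= Md //; split=> //; lia.
apply: (wp_assign (r := 4) (v := E + n + a)).
  by rewrite /= /upd /= r2 addnC; split=> //; lia.
apply: (wp_assign (r := 6) (v := E + n + b)).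
  by rewrite /= /upd /= r2 addnC; split=> //; lia.
rewrite /= /upd /= r3.
case: (ltnP da c) keepsE => ca keepsE; first case: (ltnP db c) keepsE => cb keepsE.
- split=> //=; first by rewrite /upd /=; lia.
  by split=> // v vn; rewrite keepsE /= orbF Mf.
all: have {}keepsE v : keeps (take i.+1 es) v = keeps (take i es) v || ((v == a) || (v == b))
  by rewrite keepsE ?orbT.
all: do !(split; first by lia); split=> //=; rewrite /upd /=; first lia.
all: split=> [j jE|v vn|v vn].
1,4: by case: eqP => [|_]; [lia|case: eqP => [|_]; [lia | exact: Mx]].
1,3: by case: eqP => [|_]; [lia|case: eqP => [|_]; [lia | exact: Md]].
all: rewrite !eqn_add2l keepsE Mf //.
all: by do 2 (case: eqP => _; rewrite ?orbT ?orbF //).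
Qed.

(** The shift by one lets 0 go on meaning a removed vertex, although the first kept vertex is
    renumbered 0. *)
Definition new_number (v : nat) : nat := if keeps es v then (rank v).+1 else 0.

Let Inv3 i s := [/\ consts (regs s), regs s 0 = E + n + i,
  layout (Defs.mem s) deg (fun v => if v < i then new_number v else keeps es v)
  & regs s 8 = rank i /\ regs s 11 = 0].

Lemma rank_le i : rank i <= i.
Proof. by rewrite -{2}(size_iota 0 i) count_size. Qed.

Lemma rankS i : rank i.+1 = rank i + keeps es i.
Proof. by rewrite /rank -addn1 iotaD count_cat /= addn0. Qed.

Lemma number_vertex_wp i s : i < n -> Inv3 i s -> wp B number_vertex (Inv3 i.+1) s.
Proof.
move=> i_n; case: s => r M [[/= r1 r2 r3 r5] r0 [/= Mx Md Mf] [r8 r11]].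
rewrite /wp /= /upd /= !r0 !r8 !Mf // ltnn.
have ri := rank_le i.
do !(split; first by case: (keeps _ _); lia).
have step v : (if v < i.+1 then new_number v else keeps es v) =
    if v == i then new_number i else if v < i then new_number v else keeps es v.
  by case: (ltngtP v i) => [vi|vi|->]; rewrite ?ltnSn // ltnS; [rewrite ltnW | rewrite leqNgt vi].
case ki: (keeps es i) => /=.
  do !(split; first by lia); split=> //=; rewrite /upd /=; first lia.
    split=> [j jE|v vn|v vn].
    + by case: eqP => [|_]; [lia | exact: Mx].
    + by case: eqP => [|_]; [lia | exact: Md].
    + by rewrite eqn_add2l step Mf // /new_number ki addn1.
  by rewrite rankS ki.
split; first lia.
split=> //=; rewrite /upd /=; first lia.
  split=> // v vn; rewrite step Mf //; case: eqP => // ->.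
  by rewrite ltnn /new_number ki.
by rewrite rankS ki addn0.
Qed.

(** Only the unread part of the edge list is claimed intact, since output may have replaced the
    rest; cells 2 and 3 are listed apart because they belong to the output. *)
Let Inv4 i s := [/\ consts (regs s), regs s 0 = 4 + 2 * i,
  [/\ forall j, 4 + 2 * i <= j < E -> Defs.mem s j = nth 0 w j,
      forall j, j < size (flat (out_edges (take i es))) ->
        Defs.mem s (4 + j) = nth 0 (flat (out_edges (take i es))) j,
      Defs.mem s 2 = c /\ Defs.mem s 3 = k &
      forall v, v < n -> Defs.mem s (E + n + v) = new_number v],
  regs s 8 = rank n &
  regs s 9 = 4 + size (flat (out_edges (take i es))) /\
  regs s 11 = size (out_edges (take i es))].

Lemma out_take i : i < m ->
  let: a := (nth (0, 0) es i).1 in let: b := (nth (0, 0) es i).2 in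
  out_edges (take i.+1 es) =
    if keeps es a && keeps es b then rcons (out_edges (take i es)) (rank a, rank b)
    else out_edges (take i es).
Proof.
move=> im; rewrite (take_nth (0, 0)) // /out_edges filter_rcons; case: ifP => // _.
by rewrite map_rcons.
Qed.

Lemma size_out i : i <= m -> size (out_edges (take i es)) <= i.
Proof.
move=> im; rewrite size_map size_filter; apply: leq_trans (count_size _ _) _.
by rewrite size_takel.
Qed.

Lemma output_edge_wp i s : i < m -> Inv4 i s -> wp B output_edge (Inv4 i.+1) s.
Proof.
case: s => r M im [cs r0 [Mx Mo Mck Mf] r8 [r9 r11]].
have [r1 r2 r3 r5] := cs; have [M2 M3] := Mck.
rewrite /= in r0 r1 r2 r3 r5 Mx Mo M2 M3 Mf r8 r9 r11.
have [wa wb an bn] := w_end im.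
have outE := out_take im.
have Ma : M (4 + 2 * i) = (nth (0, 0) es i).1 by rewrite Mx ?wa //; lia.
have Mb : M (4 + 2 * i).+1 = (nth (0, 0) es i).2 by rewrite Mx ?wb //; lia.
move: Ma Mb an bn outE {wa wb}.
set a := (nth _ es i).1; set b := (nth _ es i).2 => Ma Mb an bn outE.
have so := size_out (ltnW im).
have [ra rb] := (rank_le a, rank_le b).
move: Mo r9 r11 so outE; rewrite !size_flat; set o := out_edges (take i es).
move=> Mo r9 r11 so outE.
have num_le v : new_number v <= (rank v).+1 by rewrite /new_number; case: ifP.
have [na nb] := (num_le a, num_le b).
apply: (wp_assign (r := 4) (v := a)); first by rewrite /= r0 Ma; split=> //; lia.
apply: (wp_assign (r := 0) (v := (4 + 2 * i).+1)).
  by rewrite /= /upd /= r0 addn1; split=> //; lia.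
apply: (wp_assign (r := 6) (v := b)).
  by rewrite /= /upd /= Mb; split=> //; lia.
apply: (wp_assign (r := 0) (v := (4 + 2 * i).+2)).
  by rewrite /= /upd /= addn1; split=> //; lia.
apply: (wp_assign (r := 4) (v := E + n + a)).
  by rewrite /= /upd /= r2 addnC; split=> //; lia.
apply: (wp_assign (r := 4) (v := new_number a)).
  by rewrite /= /upd /= Mf //; split=> //; lia.
apply: (wp_assign (r := 6) (v := E + n + b)).
  by rewrite /= /upd /= r2 addnC; split=> //; lia.
apply: (wp_assign (r := 6) (v := new_number b)).
  by rewrite /= /upd /= Mf //; split=> //; lia.
rewrite /= /upd /= {na nb num_le} /new_number.
case ka: (keeps es a) outE => /=; last first.
  rewrite /Inv4 => -> /=; split; rewrite /= /upd /= ?size_flat //; first lia.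
  by split=> // j j1; apply: Mx; lia.
case kb: (keeps es b) => /=; last first.
  rewrite /Inv4 => -> /=; split; rewrite /= /upd /= ?size_flat //; first lia.
  by split=> // j j1; apply: Mx; lia.
rewrite /Inv4 => -> /=; rewrite !r9 !r11 !subn1 /=.
do !(split; first by lia).
split=> //; rewrite /upd /= ?flat_rcons ?size_cat ?size_rcons ?size_flat /=; try lia.
split=> [j j1|j||v vn].
(* At most [i] edges have been written before, so both new cells lie below the next unread
   address. *)
- by do 2 (case: eqP => [|_]; first lia); apply: Mx; lia.
- move=> j2; rewrite nth_cat size_flat; case: ltnP => jo.
    by do 2 (case: eqP => [|_]; first lia); apply: Mo.
  have [->|->] : j = 2 * size o \/ j = (2 * size o).+1 by lia.
    rewrite subnn; case: eqP => [|_]; first lia.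
    by rewrite eqxx.
  by rewrite subSnn addn1 -addnS eqxx.
- by [].
- by do 2 (case: eqP => [|_]; first lia); apply: Mf.
Qed.

Lemma kernelize_reaches : exists t s',
  [/\ exec B kernelize (init_state w) t s', t <= 200 * (n + m).+1 &
    holds s' ([:: rank n; size (out_edges es); c; k] ++ flat (out_edges es))].
Proof.
set out := _ ++ _.
suff [T [le [t [s' [ex tT h]]]]] : exists T, T <= 200 * (n + m).+1 /\
    reaches B kernelize (init_state w) T (fun s' => holds s' out).
  by exists t, s'; split=> //; exact: leq_trans le.
(* The total time stays an existential variable that the composition rule fills in; it is compared
   with the bound at the end. *)
eexists; split; last first.
apply: reaches_seq setup_reaches _ => s0 [c0 z0 l0 [e8 e11]].
apply: (reaches_seq (P := Inv1 (2 * m))).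
  apply: while_reaches; last first.
  - by split=> //; case: l0 => lx ld lf; split=> // v vn; rewrite take0; apply: ld.
  - exact: count_degree_wp.
  - by move=> j s jm [[/= -> _ _ _] -> _ _]; rewrite EE ltn_add2l.
move=> s1 [c1 _ l1 z1].
apply: (reaches_seq (P := Inv2 0)).
  apply: wp_reaches; split=> /=; first lia.
  split=> //; case: l1 => lx ld lf; split=> // v vn.
    by rewrite ld // take_oversize // size_flat.
  by rewrite lf // take0.
move=> s2 I2; apply: (reaches_seq (P := Inv2 m)).
  apply: while_reaches I2; last exact: mark_edge_wp.
  by move=> j s jm [[/= -> _ _ _] -> _ _]; rewrite EE ltn_add2l ltn_mul2l.
move=> s3 [c3 _ l3 [e8' e11']].
apply: (reaches_seq (P := Inv3 0)).
  apply: wp_reaches; case: c3 => c31 c32 c33 c35; split=> /=; first lia.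
  split; rewrite /= /upd /= ?addn0 //.
  by case: l3 => lx ld lf; split=> // v vn; rewrite lf // take_size.
move=> s4 I3; apply: (reaches_seq (P := Inv3 n)).
  apply: while_reaches I3; last exact: number_vertex_wp.
  by move=> j s jm [[/= _ _ _ ->] -> _ _]; rewrite mul2n -addnn addnA ltn_add2l.
move=> s5 [c5 _ l5 [e8'' e11'']].
apply: (reaches_seq (P := Inv4 0)).
  apply: wp_reaches; do !(split=> /=; first lia).
  case: l5 => lx ld lf; split; rewrite /= /upd /= ?take0 ?addn0 //; split=> //.
  - by move=> j /andP[_]; exact: lx.
  - by rewrite !lx; try lia.
  - by move=> v vn; rewrite lf // vn.
move=> s6 I4; apply: (reaches_seq (P := Inv4 m)).
  apply: while_reaches I4; last exact: output_edge_wp.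
  by move=> j s jm [[/= -> _ _ _] -> _ _]; rewrite EE ltn_add2l ltn_mul2l.
case=> r M [_ _ [/= _ Mo [M2 M3] _] e8f [_ e11f]].
apply: wp_reaches; rewrite /= /upd /= e8f e11f.
have so := size_out (leqnn m); rewrite take_size in so Mo e11f *.
have rn := rank_le n; do !(split; first by lia).
  case=> [|[|[|[|j]]]] //=; rewrite /upd //=.
  by move=> jlt; apply: (Mo j); lia.
(* With one test per round the loops and the code between them add up to 47 m + 6 n + 18, so 200 is
   generous. *)
have [-> -> ->] : [/\ cost setup = 8, cost count_degree = 6 & cost mark_edge = 14] by [].
have [-> ->] : cost number_vertex = 5 /\ cost output_edge = 17 by [].
by rewrite /=; lia.
Qed.

End Run.

(** * Encodings *)

Section Encoding.
Variables (G : sgraph) (c : nat) (num : vertex G -> nat).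
Variable es : seq (vertex G * vertex G).
Hypothesis c_gt0 : 0 < c.
Hypothesis num_inj : injective num.
Hypothesis num_lt : forall v, num v < n_vertices G.
Hypothesis es_edges : perm_eq [seq [set p.1; p.2] | p <- es] (enum (edges G)).

Let code := [seq (num p.1, num p.2) | p <- es].
Let K := kept G c.

Lemma flat_code : flat code = flatten [seq [:: num p.1; num p.2] | p <- es].
Proof. by rewrite /flat -map_comp. Qed.

Lemma mem_es_edge p : p \in es -> [set p.1; p.2] \in edges G.
Proof.
by move=> pes; rewrite -mem_enum -(perm_mem es_edges); apply/mapP; exists p.
Qed.

Lemma size_code : size code = n_edges G.
Proof. by rewrite size_map /n_edges cardE -(perm_size es_edges) size_map. Qed.

Lemma flat_code_lt v : v \in flat code -> v < n_vertices G.
Proof.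
by rewrite flat_code => /flatten_mapP[p _]; rewrite !inE => /orP[] /eqP ->.
Qed.

(** The ends of an edge differ, so each edge at [v] contributes exactly one occurrence. *)
Lemma count_flat_code v : count_mem (num v) (flat code) = degree v.
Proof.
have -> : degree v = count (fun p => v \in [set p.1; p.2]) es.
  rewrite /degree -(count_map (fun p => [set p.1; p.2]) (fun e : {set vertex G} => v \in e)).
  rewrite (permP es_edges) -size_filter cardE; apply/perm_size/uniq_perm.
  - exact: enum_uniq.
  - exact/filter_uniq/enum_uniq.
  - by move=> e; rewrite mem_enum inE andbC [RHS]mem_filter mem_enum.
have : {in es, forall p, p.1 != p.2} by move=> p /mem_es_edge /edge_neq.
rewrite flat_code; elim: es => //= p s IHs ps.
rewrite IHs => [|q qs]; last by apply: ps; rewrite inE qs orbT.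
have := ps p (mem_head _ _); rewrite !inE !(inj_eq num_inj) !(eq_sym v).
case: (eqVneq p.1 v) => [<-|_ _]; last by case: (p.2 == v).
by rewrite eq_sym => /negPf ->.
Qed.

(** The program marks vertices only while scanning edges. A high vertex is still found, since [c] is
    positive and so it has an incident edge. *)
Lemma keeps_code v : keeps c code code (num v) = (v \in K).
Proof.
rewrite /keeps has_map; apply/hasP/idP => [[p pes /=]|].
  rewrite !count_flat_code !(inj_eq num_inj) => /andP[hi /orP[] /eqP vp].
    rewrite !inE vp; case/orP: hi => hi; first by rewrite hi.
    by apply/orP; right; apply/existsP; exists p.2; rewrite inE hi mem_es_edge.
  rewrite !inE vp; case/orP: hi => hi; last by rewrite hi.
  by apply/orP; right; apply/existsP; exists p.1; rewrite inE hi setUC mem_es_edge.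
have find e : e \in edges G -> exists2 p, p \in es & e = [set p.1; p.2].
  by rewrite -mem_enum -(perm_mem es_edges) => /mapP.
rewrite !inE => /orP[hi|/existsP[y /andP[]]].
  have : 0 < degree v by exact: leq_trans hi.
  rewrite /degree card_gt0 => /set0Pn[e]; rewrite inE => /andP[/find[p pes ->] vp].
  exists p => //=; rewrite !count_flat_code !(inj_eq num_inj).
  by move: vp; rewrite !inE => /orP[] /eqP <-; rewrite hi eqxx ?orbT.
rewrite inE => hi /find[p pes E]; exists p => //=.
rewrite !count_flat_code !(inj_eq num_inj).
have vp : v \in [set p.1; p.2] by rewrite -E set21.
have yp : y \in [set p.1; p.2] by rewrite -E set22.
move: vp yp; rewrite !inE => -> /orP[] /eqP <-; by rewrite hi ?orbT.
Qed.

Let rk := rank c code.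

(** A kept [a] is itself counted below [b]; this gives both the injectivity and the range of the new
    numbering. *)
Lemma rank_lt a b : keeps c code code a -> a < b -> rk a < rk b.
Proof.
move=> ka ab; rewrite /rk /rank.
have -> : b = a + (b - a.+1).+1 by lia.
by rewrite iotaD count_cat /= ka; lia.
Qed.

Lemma rank_top : rk (n_vertices G) = #|K|.
Proof.
rewrite /rk /rank -size_filter cardE -(size_map num); apply/perm_size/uniq_perm.
- exact/filter_uniq/iota_uniq.
- by rewrite map_inj_uniq ?enum_uniq.
move=> i; rewrite mem_filter mem_iota /= add0n; apply/andP/mapP => [[ki i_n]|[v]].
  (* An injection between sets of equal size is onto, so every number below n belongs to a
     vertex. *)
  pose f v : 'I_#|vertex G| := Ordinal (num_lt v).
  have f_inj : injective f by move=> x y [/num_inj].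
  have [g fg gf] := inj_card_bij f_inj (eq_leq (card_ord _)).
  have iE : num (g (Ordinal i_n)) = i by rewrite -[LHS]/(val (f _)) gf.
  by exists (g (Ordinal i_n)) => //; rewrite mem_enum -keeps_code iE.
by rewrite mem_enum => vK ->; rewrite keeps_code.
Qed.

Let V' := vertex (induced K).
Let pair (p : vertex G * vertex G) : option (V' * V') :=
  if (insub p.1 : option {x | x \in K}, insub p.2 : option {x | x \in K})
    is (Some x, Some y) then Some (x, y) else None.
Let es' := pmap pair es.

Lemma val_es' : [seq (val p.1, val p.2) | p <- es'] = [seq p <- es | (p.1 \in K) && (p.2 \in K)].
Proof.
rewrite /es'; elim: es => //= -[x y] s IHs /=; rewrite /pair /=.
case: insubP => [x' xK xE|/negPf ->] //=; rewrite ?xK.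
by case: insubP => [y' yK yE|/negPf ->] //=; rewrite yK /= IHs xE yE.
Qed.

Lemma es'_edges : perm_eq [seq [set p.1; p.2] | p <- es'] (enum (edges (induced K))).
Proof.
(* Edges are compared through the injective image under [val], where [es'] becomes a filtered [es]
   and inherits its lack of repetitions. *)
have valE : [seq val @: (e : {set {x | x \in K}}) | e <- [seq [set p.1; p.2] | p <- es']]
    = [seq [set p.1; p.2] | p <- es & (p.1 \in K) && (p.2 \in K)].
  rewrite -val_es' -!map_comp; apply: eq_map => p /=.
  by rewrite imsetU1 imset_set1.
apply: uniq_perm; last 1 first.
- move=> e; rewrite mem_enum inE -(mem_map (imset_inj val_inj)) valE.
  apply/mapP/idP => [[p]|eG].
    by rewrite mem_filter => /andP[_ /mem_es_edge] pG ->.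
  have : val @: e \in [seq [set p.1; p.2] | p <- es] by rewrite (perm_mem es_edges) mem_enum.
  case/mapP=> p pes pE; exists p => //; rewrite mem_filter pes andbT.
  have inK x : x \in val @: e -> x \in K by case/imsetP=> z _ ->; exact: valP.
  by rewrite !inK // pE !inE eqxx ?orbT.
- apply: (@map_uniq _ _ (fun e : {set {x | x \in K}} => val @: e)); rewrite valE.
  apply: (subseq_uniq (map_subseq _ (filter_subseq _ _))).
  by rewrite (perm_uniq es_edges) enum_uniq.
- exact: enum_uniq.
Qed.

Lemma out_code : out_edges c code code = [seq (rk (num (val p.1)), rk (num (val p.2))) | p <- es'].
Proof.
rewrite /out_edges filter_map -map_comp.
have -> : [seq (rk (num (val p.1)), rk (num (val p.2))) | p <- es'] =
    [seq (rk (num p.1), rk (num p.2)) | p <- [seq (val p.1, val p.2) | p <- es']].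
  by rewrite -map_comp.
by rewrite val_es'; congr map; apply: eq_filter => p; rewrite /= !keeps_code.
Qed.

Lemma encodes_induced k :
  encodes ([:: rk (n_vertices G); size (out_edges c code code); c; k]
             ++ flat (out_edges c code code))
    (Instance (induced K) c k).
Proof.
have kept_val (x : V') : keeps c code code (num (val x)) by rewrite keeps_code (valP x).
exists (fun x : V' => rk (num (val x))), es'; split=> /=.
- move=> x y E; apply/val_inj/num_inj; apply/eqP; case: ltngtP => // lt.
    by have := rank_lt (kept_val x) lt; rewrite E ltnn.
  by have := rank_lt (kept_val y) lt; rewrite E ltnn.
- move=> x; have -> : n_vertices (induced K) = rk (n_vertices G).
    by rewrite rank_top /n_vertices card_sig; apply: eq_card.
  exact: rank_lt (kept_val x) (num_lt _).
- exact: es'_edges.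
rewrite out_code size_map rank_top; congr [:: _, _, _, _ & _].
- by rewrite /n_vertices card_sig; apply: eq_card.
- by rewrite /n_edges cardE -(perm_size es'_edges) size_map.
- by rewrite /flat -map_comp.
Qed.

End Encoding.

Theorem theorem1 :
  exists (P : cmd) (a Ctime Cedges : nat),
  forall (I : instance) (w : seq nat),
    0 < colors I -> encodes w I ->
    exists (t : nat) (w' : seq nat) (I' : instance),
      [/\ runs (word_bound a I) P w t w',
          t <= Ctime * (n_vertices (graph I) + n_edges (graph I)).+1,
          encodes w' I' /\ (ECS I' <-> ECS I),
          n_vertices (graph I') <= 4 * xi (colors I - 1) (graph I) * colors I &
          n_edges (graph I')
            <= Cedges * (xi (colors I - 1) (graph I) * colors I ^ 2)].
Proof.
(* The first 4 suits the word bound: addresses and values written stay within 4 + 2m + 2n + c. *)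
exists kernelize, 4, 200, 4 => -[G c k] w /= c_gt0 [num [es [num_inj num_lt es_edges ->]]].
pose code := [seq (num p.1, num p.2) | p <- es].
have B_big : 4 + 2 * size code + 2 * n_vertices G + c <= word_bound 4 (Instance G c k).
  by rewrite (size_code num es_edges) /word_bound /=; lia.
have [t [s [run time out]]] := kernelize_reaches k (flat_code_lt num_lt) B_big.
exists t, ([:: rank c code (n_vertices G); size (out_edges c code code); c; k]
             ++ flat (out_edges c code code)), (Instance (induced (kept G c)) c k).
rewrite (size_code num es_edges) in run time; split=> //=.
- by exists s; rewrite // -flat_code.
- split; first exact: encodes_induced.
  by apply: ECS_induced => u x; exact: kept_low.
- by rewrite /n_vertices card_sig; apply: leq_trans (card_kept G c_gt0); rewrite cardsE.
- exact: card_edges_induced_kept.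
Qed.
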